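(* Let $S$ be a compact Hausdorff space without isolated points, let $u\in C(S)$ with $u\not\equiv 0$, and let $\varphi:S\to S$ be a continuous function. Then $$\|uC_\varphi+T\|=\|u\|_\infty+\|T\|\quad\text{for every weakly compact operator } T:C(S)\to C(S)$$ if and only if $\varphi^{-1}(\{t\})$ is nowhere dense in $S$ for every $t\in S$ and $|u|$ is constant on $S$.
   Context: $C(S)$ is the Banach space of continuous functions $S\to\mathbb{C}$ with the supremum norm $\|\cdot\|_\infty$. The weighted composition operator $uC_\varphi:C(S)\to C(S)$ is $uC_\varphi(f)=u\cdot(f\circ\varphi)$; its operator norm is $\|u\|_\infty$. Operators are bounded and linear; norms of operators are operator norms. *)

(* Defs.v *)
From HB Require Import structures.
From mathcomp Require Import all_boot all_order all_algebra.
From mathcomp Require Import complex lra.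
From mathcomp Require Import all_classical all_reals all_analysis.

Set Implicit Arguments.
Unset Strict Implicit.
Unset Printing Implicit Defensive.

Import Order.TTheory GRing.Theory Num.Theory.
Import numFieldNormedType.Exports.

Local Open Scope classical_set_scope.
Local Open Scope complex_scope.
Local Open Scope ring_scope.

(* The scalar field is [R[i]]; as a normed space over itself it is written
   [R[i]^o], because the default module structure of [R[i]] in real_closed is
   the one over [R].  The norm of a [normedModType R[i]] takes its values in
   [R[i]]; [rnorm] is the same number seen as an element of [R]. *)
Definition rnorm (R : realType) (V : normedModType R[i]) (v : V) : R :=
  complex.Re `|v|.

Section rnorm_theory.
Context {R : realType}.

Lemma rnormE (V : normedModType R[i]) (v : V) : (rnorm v)%:C = `|v|.
Proof. by rewrite /rnorm RRe_real // normr_real. Qed.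

Lemma rnorm_le (V W : normedModType R[i]) (v : V) (w : W) :
  (rnorm v <= rnorm w) = (`|v| <= `|w|).
Proof. by rewrite -!rnormE lecR. Qed.

Lemma rnorm_ge0 (V : normedModType R[i]) (v : V) : 0 <= rnorm v.
Proof. by rewrite -lecR rnormE normr_ge0. Qed.

Lemma rnormD (V : normedModType R[i]) (v w : V) :
  rnorm (v + w) <= rnorm v + rnorm w.
Proof. by rewrite -lecR rmorphD/= !rnormE ler_normD. Qed.

Lemma rnormN (V : normedModType R[i]) (v : V) : rnorm (- v) = rnorm v.
Proof. by rewrite /rnorm normrN. Qed.

Lemma rnormZ (V : normedModType R[i]) (a : R[i]) (v : V) :
  rnorm (a *: v) = rnorm (a : R[i]^o) * rnorm v.
Proof.
have -> : rnorm (a *: v) = complex.Re (rnorm (a *: v))%:C by [].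
by rewrite rnormE normrZ -(rnormE v) -(rnormE (a : R[i]^o)) -rmorphM.
Qed.

Lemma rnorm_continuous (V : normedModType R[i]) :
  continuous (@rnorm R V).
Proof.
move=> v; apply/cvgrPdist_lt => e e0; near=> w.
have h : `|v - w| < e%:C.
  by near: w; apply: (@cvgr_dist_lt _ V _ _ _ id v) => //; rewrite ltcR.
rewrite -ltcR; apply: le_lt_trans h; rewrite -rnormE lecR ler_norml.
have le1 := rnormD (v - w) w; rewrite subrK in le1.
have le2 := rnormD (w - v) v; rewrite subrK -opprB rnormN in le2.
by apply/andP; split; lra.
Unshelve. all: by end_near. Qed.

End rnorm_theory.

(* Without compactness of [S] the supremum norm is not a norm, hence the proof
   [cS] as a parameter of the type. *)
Definition Cspace (R : realType) (S : topologicalType)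
  (cS : compact [set: S]) : Type := continuousType S (R[i]^o).
Arguments Cspace : clear implicits.
Arguments Cspace R {S} cS.

Section Cspace_normedModType.
Context {R : realType} {S : topologicalType} {cS : compact [set: S]}.
Local Notation C := (Cspace R cS).

HB.instance Definition _ := Choice.copy C (continuousType S (R[i]^o)).

Lemma CspaceP (f g : C) : (forall s, f s = g s) -> f = g.
Proof. by move=> fg; apply/continuousEP => s; exact: fg. Qed.

Lemma Cspace_continuous (f : C) : continuous (f : S -> R[i]^o).
Proof. exact: cts_fun. Qed.

Definition mkC (f : S -> R[i]^o) (cf : continuous f) : C :=
  (mkcts cf : continuousType S (R[i]^o)).

Lemma Czero_subproof : continuous ((fun=> 0) : S -> R[i]^o).
Proof. by move=> s; exact: cvg_cst. Qed.
Definition Czero : C := mkC Czero_subproof.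

Lemma Copp_subproof (f : C) : continuous (fun s => - f s).
Proof. by move=> s; apply: cvgN; exact: Cspace_continuous. Qed.
Definition Copp (f : C) : C := mkC (@Copp_subproof f).

Lemma Cadd_subproof (f g : C) : continuous (fun s => f s + g s).
Proof. by move=> s; apply: cvgD; exact: Cspace_continuous. Qed.
Definition Cadd (f g : C) : C := mkC (@Cadd_subproof f g).

Lemma Cscale_subproof (a : R[i]) (f : C) : continuous (fun s => a *: f s).
Proof. by move=> s; apply: cvgZr; exact: Cspace_continuous. Qed.
Definition Cscale (a : R[i]) (f : C) : C := mkC (@Cscale_subproof a f).

Lemma CaddA : associative Cadd.
Proof. by move=> f g h; apply: CspaceP => s; exact: addrA. Qed.
Lemma CaddC : commutative Cadd.
Proof. by move=> f g; apply: CspaceP => s; exact: addrC. Qed.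
Lemma Cadd0 : left_id Czero Cadd.
Proof. by move=> f; apply: CspaceP => s; exact: add0r. Qed.
Lemma CaddN : left_inverse Czero Copp Cadd.
Proof. by move=> f; apply: CspaceP => s; exact: addNr. Qed.

HB.instance Definition _ := GRing.isZmodule.Build C CaddA CaddC Cadd0 CaddN.

Lemma CscaleA (a b : R[i]) (f : C) : Cscale a (Cscale b f) = Cscale (a * b) f.
Proof. by apply: CspaceP => s; exact: scalerA. Qed.
Lemma Cscale1 : left_id 1 Cscale.
Proof. by move=> f; apply: CspaceP => s; exact: scale1r. Qed.
Lemma CscaleDr : right_distributive Cscale +%R.
Proof. by move=> a f g; apply: CspaceP => s; exact: scalerDr. Qed.
Lemma CscaleDl (f : C) : {morph Cscale^~ f : a b / a + b}.
Proof. by move=> a b; apply: CspaceP => s; exact: scalerDl. Qed.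

HB.instance Definition _ :=
  GRing.Zmodule_isLmodule.Build R[i] C CscaleA Cscale1 CscaleDr CscaleDl.

Lemma CaddE (f g : C) s : (f + g) s = f s + g s. Proof. by []. Qed.
Lemma CscaleE (a : R[i]) (f : C) s : (a *: f) s = a * f s. Proof. by []. Qed.

Definition supnorm (f : C) : R := sup (range (fun s => rnorm (f s))).

Lemma supnorm_has_ubound (f : C) : has_ubound (range (fun s => rnorm (f s))).
Proof.
have cf : {within [set: S], continuous (fun s => rnorm (f s))}.
  apply: continuous_subspaceT => s.
  by apply: (@continuous_comp _ _ _ f); [exact: Cspace_continuous|exact: rnorm_continuous].
have [M [_ Mf]] := compact_bounded (continuous_compact cf cS).
exists (M + 1) => y fy.
by apply: (le_trans (ler_norm y)); apply: Mf fy; rewrite ltrDl.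
Qed.

Lemma supnorm_ub (f : C) s : rnorm (f s) <= supnorm f.
Proof. by apply: ub_le_sup; [exact: supnorm_has_ubound|exists s]. Qed.

(* the hypothesis [0 <= M] is for the empty space *)
Lemma supnorm_le (f : C) (M : R) :
  0 <= M -> (forall s, rnorm (f s) <= M) -> supnorm f <= M.
Proof.
move=> M0 fM; have [[s _]|/forallNP S0] := pselect (exists s : S, True).
  by apply: ge_sup; [exists (rnorm (f s)), s|move=> _ [t _ <-]].
rewrite /supnorm [X in sup X](_ : _ = set0) ?sup0//.
by rewrite -subset0 => y [s _ _]; case: (S0 s).
Qed.

Lemma supnorm_ge0 (f : C) : 0 <= supnorm f.
Proof.
have [[s _]|/forallNP S0] := pselect (exists s : S, True).
  exact: le_trans (rnorm_ge0 _) (supnorm_ub f s).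
rewrite /supnorm [X in sup X](_ : _ = set0) ?sup0//.
by rewrite -subset0 => y [s _ _]; case: (S0 s).
Qed.

Definition Cnorm (f : C) : R[i] := (supnorm f)%:C.

Lemma CnormD (f g : C) : Cnorm (f + g) <= Cnorm f + Cnorm g.
Proof.
rewrite /Cnorm -rmorphD lecR; apply: supnorm_le => [|s].
  by rewrite addr_ge0 ?supnorm_ge0.
by rewrite CaddE (le_trans (rnormD _ _))// lerD ?supnorm_ub.
Qed.

Lemma CnormZ (a : R[i]) (f : C) : Cnorm (a *: f) = `|a| * Cnorm f.
Proof.
have le (b : R[i]) g : supnorm (b *: g) <= rnorm (b : R[i]^o) * supnorm g.
  apply: supnorm_le => [|s]; first by rewrite mulr_ge0 ?rnorm_ge0 ?supnorm_ge0.
  rewrite (rnormZ b (g s)) ler_wpM2l ?rnorm_ge0 ?supnorm_ub//.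
rewrite -[`|a|](rnormE (a : R[i]^o)) /Cnorm -rmorphM; congr (_%:C).
apply/eqP; rewrite eq_le le/=.
have [->|a0] := eqVneq a 0.
  by rewrite [rnorm _](_ : _ = 0) ?mul0r ?supnorm_ge0// /rnorm normr0.
have := le a^-1 (a *: f); rewrite scalerA mulVf// scale1r.
have ra0 : 0 < rnorm (a : R[i]^o) by rewrite -ltcR rnormE normr_gt0.
have aV : rnorm (a : R[i]^o) * rnorm (a^-1 : R[i]^o) = 1.
  rewrite -rnormZ [_ *: _](_ : _ = 1); first by rewrite /rnorm normr1.
  exact: divff.
by rewrite -(ler_pM2l ra0) mulrA aV mul1r.
Qed.

Lemma Cnorm0_eq0 (f : C) : Cnorm f = 0 -> f = 0.
Proof.
move=> /(congr1 (@complex.Re R)) /= f0; apply: CspaceP => s.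
apply/eqP; rewrite -normr_le0 -rnormE lecR -f0; exact: supnorm_ub.
Qed.

HB.instance Definition _ :=
  Lmodule_isNormed.Build R[i] C CnormD CnormZ Cnorm0_eq0.

Lemma Cspace_normE (f : C) : `|f| = (supnorm f)%:C. Proof. by []. Qed.

Lemma wcomp_subproof (u : C) (phi : continuousType S S) :
  forall f : C, continuous (fun s => (u s : R[i]) * (f (phi s) : R[i]) : R[i]^o).
Proof.
move=> f s; apply: (@cvgM R[i]); first exact: Cspace_continuous.
by apply: (@continuous_comp _ _ _ phi); [exact: cts_fun|exact: Cspace_continuous].
Qed.

Definition wcomp (u : C) (phi : continuousType S S) (f : C) : C :=
  mkC (@wcomp_subproof u phi f).

Lemma wcompE (u : C) (phi : continuousType S S) (f : C) s :
  wcomp u phi f s = (u s : R[i]) * (f (phi s) : R[i]).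
Proof. by []. Qed.

Lemma wcomp_linear (u : C) (phi : continuousType S S) : linear (wcomp u phi).
Proof.
move=> a f g; apply: CspaceP => s.
by rewrite CaddE CscaleE !wcompE CaddE CscaleE mulrDr mulrCA.
Qed.

HB.instance Definition _ (u : C) (phi : continuousType S S) :=
  GRing.isLinear.Build R[i] C C _ (wcomp u phi) (wcomp_linear u phi).

End Cspace_normedModType.

(* [sup] returns 0 on sets without supremum, so this is the operator norm only
   for bounded [T]. *)
Definition opnorm (R : realType) (V W : normedModType R[i]) (T : V -> W) : R :=
  sup [set rnorm (T v) | v in [set v : V | `|v| <= 1]].

(* [V] with the coarsest topology making every functional of its topological
   dual continuous *)
Definition weak (K : numFieldType) (V : normedModType K) : Type :=
  sup_topology (fun f : {f : {linear V -> K^o} | continuous f} =>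
    Topological.class (initial_topology (sval f : V -> K^o))).

HB.instance Definition _ (K : numFieldType) (V : normedModType K) :=
  Topological.on (weak V).

Lemma weak_cvgP (K : numFieldType) (V : normedModType K) (F : set_system V)
    (x : V) : Filter F ->
  (F --> (x : weak V)) <->
  (forall f : {linear V -> K^o}, continuous f -> f @ F --> f x).
Proof.
move=> FF; rewrite cvg_sup; split.
  move=> h f cf A fA; have := h (exist _ f cf) (f @^-1` A); apply.
  exact: (@initial_continuous V K^o f x A fA).
move=> h [f cf] A /=.
rewrite (@nbhsE (initial_topology (f : V -> K^o))) => -[B [[C oC <-] /= Cx] BA].
by apply: filterS BA _; apply: (h f cf); exact: open_nbhs_nbhs.
Qed.

(* closure and compactness are both taken in [weak W] *)
Definition weakly_compact (K : numFieldType) (V W : normedModType K)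
    (T : V -> W) : Prop :=
  compact (closure (T @` [set v : V | `|v| <= 1] : set (weak W))).

Definition nowhere_dense (S : topologicalType) (A : set S) : Prop :=
  interior (closure A) = set0.

(* Main.v *)
(** Necessity is tested on rank-one operators [f |-> f(t) g] with [g] a Urysohn
    function.  If [|u| < ||u||] near [s], taking [g] supported near [s] makes
    the norm of the sum too small; if [phi] is constant equal to [t] on an open
    set, [g = - u p] with [p] supported in that set cancels [u C_phi].

    For sufficiency no representing measures are needed.  For each [t] let
    [g_t] in [C(S)] be a weak cluster point of [T p] as [p] runs through
    Urysohn functions peaking at [t] with supports shrinking to [t]; [g_t(s)]
    stands for the mass that the functional [f |-> (T f)(s)] puts on [t].
    Many distinct [t] with [|g_t(s)| > a] at a common [s] contradict
    boundedness of [T].  As each [g_t] is continuous and the fibres of [phi]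
    are nowhere dense, [|g_{phi(s)}(s)| > a] cannot hold on a nonempty open
    set: one could keep picking points with new values of [phi].  Hence, if
    [||T f||] almost attains [||T||], there is [s] where [|(T f)(s)|] is almost
    [||T||] and [g_{phi(s)}(s)] is small, so [f] can be modified near [phi(s)]
    to align [u(s) f(phi(s))] with [(T f)(s)] while hardly changing the
    latter. *)

Require Import Defs.
From HB Require Import structures.
From mathcomp Require Import all_boot all_order all_algebra.
From mathcomp Require Import complex ring lra.
From mathcomp Require Import all_classical all_reals all_analysis.
Import Order.TTheory GRing.Theory Num.Theory.
Import numFieldNormedType.Exports.
Local Open Scope classical_set_scope.
Local Open Scope ring_scope.

Set Implicit Arguments.
Unset Strict Implicit.
Local Open Scope complex_scope.

(** * Moduli and phases of complex scalars *)

Section scalars.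
Context {R : realType}.
Implicit Types a b w : R[i]^o.

Lemma rnorm0 (V : normedModType R[i]) : rnorm (0 : V) = 0 :> R.
Proof. by rewrite /rnorm normr0. Qed.

Lemma rnorm1 : rnorm (1 : R[i]^o) = 1 :> R.
Proof. by rewrite /rnorm normr1. Qed.

Lemma rnormM a b : rnorm (a * b : R[i]^o) = rnorm a * rnorm b.
Proof. exact: (rnormZ a b). Qed.

Lemma rnormC (x : R) : 0 <= x -> rnorm (x%:C : R[i]^o) = x.
Proof. by move=> x0; rewrite /rnorm ger0_norm// lecR. Qed.

Lemma phase a : exists2 w : R[i]^o, rnorm w = 1 & w * a = (rnorm a)%:C.
Proof.
have [->|a0] := eqVneq a 0; first by exists 1; rewrite ?rnorm1// rnorm0 mulr0.
have ra0 : (rnorm a)%:C != 0 by rewrite rnormE normr_eq0.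
exists ((rnorm a)%:C / a); last by rewrite divfK.
have : rnorm ((rnorm a)%:C / a * a : R[i]^o) = rnorm a.
  by rewrite divfK// rnormC// rnorm_ge0.
rewrite rnormM -[RHS]mul1r => /mulIf; apply.
by apply: contra_neq ra0 => ->.
Qed.

(** If [v] and [w] turn [a] and [b] into their moduli, the factor [v / w] gives [a] the argument of
    [b]. *)
Lemma aligned a b :
  exists2 w : R[i]^o,
    rnorm w = 1 & rnorm (a * w + b : R[i]^o) = rnorm a + rnorm b.
Proof.
have [v v1 va] := phase a; have [w w1 wb] := phase b.
have w0 : w != 0 by apply: contra_eq_neq w1 => ->; rewrite rnorm0 eq_sym oner_eq0.
have E : w * (a * (v / w) + b) = (rnorm a + rnorm b)%:C.
  by rewrite mulrDr wb rmorphD/= -va mulrCA [w * (v / w)]mulrC divfK// [a * v]mulrC.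
exists (v / w).
  have : rnorm ((v / w) * w : R[i]^o) = rnorm v by rewrite divfK.
  by rewrite rnormM v1 w1 mulr1.
by rewrite -[LHS]mul1r -w1 -rnormM E rnormC// addr_ge0// rnorm_ge0.
Qed.

End scalars.

(** * Operator norms and continuity of linear maps *)

Section opnorm.
Context {R : realType} {V W : normedModType R[i]}.

(** [M] makes the set of values bounded, so that [sup] does not return its default 0. *)
Lemma opnorm_ub (T : V -> W) (M : R) :
  (forall v, `|v| <= 1 -> rnorm (T v) <= M) ->
  forall v, `|v| <= 1 -> rnorm (T v) <= opnorm T.
Proof.
move=> TM v v1; apply: ub_le_sup; last by exists v.
by exists M => _ [w w1 <-]; exact: TM.
Qed.

Lemma opnorm_le (T : V -> W) (M : R) :
  (forall v, `|v| <= 1 -> rnorm (T v) <= M) -> opnorm T <= M.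
Proof.
move=> TM; apply: ge_sup; last by move=> _ [v v1 <-]; exact: TM.
by exists (rnorm (T 0)); exists 0 => //=; rewrite normr0.
Qed.

Lemma continuous_opnorm_ub (T : {linear V -> W}) : continuous T ->
  forall v, `|v| <= 1 -> rnorm (T v) <= opnorm T.
Proof.
move=> cT; have /linear_bounded_continuous/linear_boundedP := cT.
case=> r [rreal rT] v v1.
pose M := `|r| + 1.
have rM : r < M by rewrite /M (le_lt_trans (real_ler_norm _))// ltrDl.
apply: (@opnorm_ub _ (complex.Re M)) => // {v1}v v1.
rewrite -lecR rnormE RRe_real; last first.
  by rewrite /M realD// ?normr_real// real1.
apply: le_trans (rT _ rM v) _; rewrite ler_piMr//.
by rewrite /M addr_ge0.
Qed.

Lemma opnorm_approx (T : V -> W) (x : R) : x < opnorm T ->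
  exists2 v, `|v| <= 1 & x < rnorm (T v).
Proof.
move=> /sup_gt[|_ [v v1 <-] xv]; last by exists v.
by exists (rnorm (T 0)); exists 0 => //=; rewrite normr0.
Qed.

Lemma opnorm_bound (T : {linear V -> W}) (M : R) :
  (forall v, `|v| <= 1 -> rnorm (T v) <= M) ->
  forall v, rnorm (T v) <= opnorm T * rnorm v.
Proof.
move=> TM v; have [->|v0] := eqVneq v 0.
  by rewrite linear0 !rnorm0 mulr0.
have rv0 : 0 < rnorm v by rewrite -ltcR rnormE normr_gt0.
have rV : rnorm (((rnorm v)^-1)%:C : R[i]^o) = (rnorm v)^-1.
  by rewrite rnormC// invr_ge0 ltW.
rewrite -ler_pdivrMr// mulrC -rV -rnormZ -linearZ.
apply: (opnorm_ub TM); rewrite -rnormE rnormZ rV mulVf//.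
by rewrite gt_eqF.
Qed.

End opnorm.

Lemma real_complex_continuous (R : realType) :
  continuous (fun x : R => x%:C : R[i]^o).
Proof.
move=> x; apply/cvgrPdist_lt => e e0.
have er : (complex.Re e)%:C = e by rewrite RRe_real// gtr0_real.
have e0' : 0 < complex.Re e by rewrite -ltcR er.
near=> y; rewrite -rmorphB -rnormE -er ltcR.
have -> : rnorm ((x - y)%:C : R[i]^o) = `|x - y|.
  by rewrite /rnorm normc_def/= expr0n addr0 sqrtr_sqr.
by near: y; apply: (@cvgr_dist_lt _ _ _ _ _ id).
Unshelve. all: by end_near. Qed.

Lemma lipschitz_linear_continuous (R : realType) (V W : normedModType R[i])
    (T : {linear V -> W}) (M : R) :
  (forall v, rnorm (T v) <= M * rnorm v) -> continuous T.
Proof.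
move=> TM; apply/linear_bounded_continuous/linear_boundedP; near=> r => v.
apply: (@le_trans _ _ (M%:C * `|v|)); first by rewrite -!rnormE -rmorphM/= lecR.
rewrite ler_wpM2r//; near: r; apply: nbhs_pinfty_ge.
by rewrite realE !lecR -realE num_real.
Unshelve. all: by end_near. Qed.

(** * Evaluations, the weak topology and rank-one operators on continuous functions *)

Section continuous_functions.
Context {R : realType} {S : topologicalType} {cS : compact [set: S]}.
Local Notation C := (Cspace R cS).
Implicit Types (f g h : C) (s t : S).

Lemma Cspace_norm_le1 f : `|f| <= 1 <-> forall s, rnorm (f s) <= 1.
Proof.
rewrite Cspace_normE (lecR (supnorm f) 1); split=> [f1 s|].
  exact: le_trans (supnorm_ub f s) f1.
exact: supnorm_le.
Qed.

Lemma continuous_rnorm f : continuous (fun s => rnorm (f s)).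
Proof.
move=> s; apply: (@continuous_comp _ _ _ f); first exact: Cspace_continuous.
exact: rnorm_continuous.
Qed.

Lemma open_rnorm_gt f (a : R) : open [set s | a < rnorm (f s)].
Proof.
apply: (@open_comp _ _ (fun s => rnorm (f s)) [set x | a < x]).
  by move=> s _; exact: continuous_rnorm.
exact: open_gt.
Qed.

Lemma open_rnorm_lt f (a : R) : open [set s | rnorm (f s) < a].
Proof.
apply: (@open_comp _ _ (fun s => rnorm (f s)) [set x | x < a]).
  by move=> s _; exact: continuous_rnorm.
exact: open_lt.
Qed.

Definition evC s f : R[i]^o := f s.

Lemma evC_linear s : linear (evC s).
Proof. by []. Qed.

HB.instance Definition _ s :=
  GRing.isLinear.Build R[i] C R[i]^o _ (evC s) (@evC_linear s).

Lemma evC_continuous s : continuous (evC s).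
Proof.
apply: (@lipschitz_linear_continuous _ _ _ _ 1) => f.
by rewrite mul1r; exact: supnorm_ub.
Qed.

Lemma weak_nbhs_ev g s (e : R) : 0 < e ->
  nbhs (g : weak C) [set f : C | rnorm (f s - g s) < e].
Proof.
move=> e0.
have /(weak_cvgP g) : nbhs (g : weak C) --> (g : weak C) by [].
move=> /(_ (evC s) (@evC_continuous s)).
move=> /cvgr_distC_lt /(_ e%:C); rewrite ltcR => /(_ e0).
apply: filterS => f /=.
by rewrite -rnormE ltcR.
Qed.

(** Evaluations are weakly continuous and separate points. *)
Lemma weak_hausdorff : hausdorff_space (weak C).
Proof.
move=> f g fg; apply: CspaceP => s; apply/eqP; rewrite -subr_eq0 -normr_le0.
rewrite -rnormE lecR leNgt; apply/negP => d0.
have d20 : 0 < rnorm (f s - g s) / 2 by rewrite divr_gt0.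
have [h [/= hf hg]] := fg _ _ (weak_nbhs_ev f s d20) (weak_nbhs_ev g s d20).
have := rnormD (f s - h s) (h s - g s).
rewrite addrA subrK leNgt => /negP; apply.
rewrite -(opprB (h s)) rnormN; lra.
Qed.

Definition rank1 t g f : C := f t *: g.

Lemma rank1_linear t g : linear (rank1 t g).
Proof. by move=> a f h; rewrite /rank1 CaddE CscaleE scalerDl scalerA. Qed.

HB.instance Definition _ t g :=
  GRing.isLinear.Build R[i] C C _ (rank1 t g) (rank1_linear t g).

Lemma rank1_continuous t g : continuous (rank1 t g).
Proof.
apply: (@lipschitz_linear_continuous _ _ _ _ (rnorm g)) => f.
rewrite [X in X <= _](rnormZ (f t) g) mulrC ler_wpM2l ?rnorm_ge0//.
exact: supnorm_ub.
Qed.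

(** The image of the unit ball lies in the multiples of [g] by scalars from a square. These form a
    continuous image of a compact set, hence a weakly compact set, closed because the weak topology
    is Hausdorff. *)
Lemma rank1_weakly_compact t g : weakly_compact (rank1 t g).
Proof.
pose z (xy : R * R) : R[i]^o := xy.1%:C + 'i%C * xy.2%:C.
have cz : continuous z.
  move=> xy; apply: (@cvgD R[i] R[i]^o).
    by apply: (continuous_comp cvg_fst); exact: real_complex_continuous.
  apply: (@cvgMl_tmp R[i]).
  by apply: (continuous_comp cvg_snd); exact: real_complex_continuous.
pose k (xy : R * R) : weak C := (z xy : R[i]) *: (g : C).
have ck : continuous k.
  move=> xy; apply/(weak_cvgP (k xy)) => f _.
  have fk : f \o k = (fun xy => z xy * f g).
    by apply/funext => ab; rewrite /k /= linearZ.
  rewrite -[f (k xy)]/((f \o k) xy) -fmap_comp fk.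
  by apply: (@cvgMr_tmp R[i]); exact: cz.
have cK : compact (k @` (`[-1, 1] `*` `[-1, 1])).
  apply: continuous_compact; first exact: continuous_subspaceT.
  by apply: compact_setX; exact: segment_compact.
apply: (subclosed_compact _ cK); first exact: closed_closure.
have /closure_id -> := compact_closed weak_hausdorff cK.
apply: closureS => _ [f /Cspace_norm_le1 /(_ t) ft <-].
exists (complex.Re (f t), complex.Im (f t)) => /=.
  split; rewrite in_itv/= -ler_norml -lecR; apply: (@le_trans _ _ `|f t : R[i]|).
  - exact: normc_ge_Re.
  - by rewrite -[leLHS](rnormE (f t : R[i]^o)) lecR.
  - by rewrite normc_def lecR -sqrtr_sqr ler_wsqrtr// lerDr sqr_ge0.
  - by rewrite -[leLHS](rnormE (f t : R[i]^o)) lecR.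
by rewrite /k /z/= -complexE.
Qed.

End continuous_functions.

(** * Urysohn functions and atoms of an operator *)

Section bumps.
Context {R : realType} {S : topologicalType} {cS : compact [set: S]}.
Hypothesis hS : hausdorff_space S.
Local Notation C := (Cspace R cS).
Implicit Types (f g h : C) (s t : S) (V : set S).

Definition bump t V f :=
  [/\ f t = 1, forall s, ~ V s -> f s = 0 & forall s, 0 <= (f s : R[i]) <= 1].

Lemma bump_ball t V f : bump t V f -> `|f| <= 1.
Proof.
case=> _ _ f01; apply/Cspace_norm_le1 => s; have /andP[f0 f1] := f01 s.
by rewrite -lecR rnormE ger0_norm.
Qed.

Lemma bump_exists t V : nbhs t V -> exists f, bump t V f.
Proof.
move=> /[dup] /nbhs_singleton Vt tV.
have [] := (@normal_separatorP R S).1 (compact_normal hS cS) (~` V°) [set t].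
- by apply: open_closedC; exact: open_interior.
- exact: accessible_closed_set1 (hausdorff_accessible hS) t.
- by rewrite -subset0 => s [/[swap] -> nV]; apply: nV.
move=> uT [E EH].
have /(uniform_separatorP (R := R)) [f [cf f01 f0 f1]] :
  uniform_separator (~` V°) [set t] by exists uT, E.
have cfC : continuous (fun s => (f s)%:C : R[i]^o).
  move=> s; apply: (continuous_comp (cf s)); exact: real_complex_continuous.
exists (mkC cfC); split => [|s nVs|s].
- by rewrite -[LHS]/((f t)%:C) (f1 (f t))//; exists t.
- by rewrite -[LHS]/((f s)%:C) (f0 (f s))//; exists s => // /interior_subset.
- rewrite -[mkC _ s]/((f s)%:C) (lecR 0) (lecR _ 1).
  by apply: f01; exists s.
Qed.

(* [g s] plays the role of the mass at [t] of the measure representing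
   [f |-> T f s]; weak compactness makes it continuous in [s]. *)
Definition atom (T : C -> C) t g := forall s V (e : R), nbhs t V -> 0 < e ->
  exists2 f, bump t V f & rnorm (T f s - g s) < e.

Lemma weakly_compact_atom (T : C -> C) t :
  weakly_compact T -> exists g, atom T t g.
Proof.
move=> cT.
(* Urysohn's lemma makes this filter proper; one cluster point serves all [s] at once. *)
pose F : set_system (weak C) := filter_from (nbhs t) (fun V => T @` bump t V).
have PF : ProperFilter F.
  apply: filter_from_proper; last first.
    by move=> V /bump_exists[f Vf]; exists (T f), f.
  apply: filter_from_filter; first by exists setT; exact: filterT.
  move=> U V tU tV; exists (U `&` V); first exact: filterI.
  move=> _ [f [ft f0 f01] <-]; split; exists f => //; split=> // s ns;
    by apply: f0 => -[].
have [|g [_ Fg]] := cT F PF.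
  exists setT; first exact: filterT.
  by move=> _ [f /bump_ball f1 <-]; apply: subset_closure; exists f.
exists g => s V e tV e0.
have [|_ [[f Vf <-] /= fg]] := Fg (T @` bump t V) _ _ (weak_nbhs_ev g s e0).
  by exists V.
by exists f.
Qed.

(** Induction on [l]: [t] and the remaining points get disjoint neighbourhoods, so the bump at [t]
    and the function built for the rest do not overlap and their sum stays in the unit ball. [V]
    varies so that the rest can be confined. *)
Lemma atom_sum (T : {linear C -> C}) (g : S -> C) (a : R) s (l : seq S) V :
  (forall t, atom T t (g t)) -> uniq l ->
  (forall t, t \in l -> a < rnorm (g t s)) -> (forall t, t \in l -> nbhs t V) ->
  exists h : C, [/\ `|h| <= 1, forall x, ~ V x -> h x = 0 &
    exists2 r, T h s = r%:C & (size l)%:R * a <= r].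
Proof.
move=> gT; elim: l V => [|t l IH] V /=.
  move=> _ _ _; exists 0; split => //; first by rewrite normr0.
  by exists 0; rewrite ?linear0// mul0r.
move=> /andP[tl ul] la lV.
have treg : {for t, regular_space S}.
  exact: (@compact_regular _ t setT hS cS filterT).
have [|/=|A [B [oA oB At lB AB0]]] := (regular_openP t).1 treg [set` l].
- by apply: (accessible_finite_set_closed (T := S)).1 => //; exact: hausdorff_accessible.
- exact/negP.
have AV : nbhs t (V `&` A).
  by apply: filterI; [apply: lV; rewrite mem_head|exact: open_nbhs_nbhs].
have [|x xl|h [h1 h0 [r hr lr]]] := IH (V `&` B) ul.
- by move=> x xl; apply: la; rewrite in_cons xl orbT.
- apply: filterI; first by apply: lV; rewrite in_cons xl orbT.
  by apply: open_nbhs_nbhs; split=> //; exact: lB.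
have d0 : 0 < rnorm (g t s) - a by rewrite subr_gt0 la// mem_head.
have [f Vf fg] := gT t s _ _ AV d0.
have af : a < rnorm (T f s).
  have := rnormD (T f s) (g t s - T f s).
  rewrite addrC subrK -(opprB (T f s)) rnormN; lra.
(* Rotating the bump makes its contribution at [s] equal to its modulus, so that contributions add
   up without cancellation. *)
have [w w1 wf] := phase (T f s).
have [_ f0 _] := Vf; have /Cspace_norm_le1 f1 := bump_ball Vf.
move/Cspace_norm_le1 in h1.
exists (w *: f + h); split.
- apply/Cspace_norm_le1 => x; rewrite CaddE CscaleE.
  have [Ax|nAx] := pselect (A x).
    rewrite h0 ?addr0 ?rnormM ?w1 ?mul1r// => -[_ Bx].
    by have : (A `&` B) x by []; rewrite AB0.
  by rewrite f0 ?mulr0 ?add0r// => -[].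
- move=> x nVx; rewrite CaddE CscaleE f0 ?h0 ?mulr0 ?addr0// => -[] //.
- exists (rnorm (T f s) + r).
    by rewrite linearD linearZ CaddE CscaleE hr wf rmorphD.
  by rewrite -natr1 mulrDl mul1r addrC lerD// ltW.
Qed.

End bumps.

(** * Sufficiency: small atoms and near-extremal test functions *)

Section daugavet.
Context {R : realType} {S : topologicalType} {cS : compact [set: S]}.
Hypothesis hS : hausdorff_space S.
Local Notation C := (Cspace R cS).
Variable phi : continuousType S S.

(** Induction on [n]: for [s] in [W] the point [phi s] is new, since [phi] avoids [l] on [W], and
    its atom stays above [a] near [s] by continuity. *)
Lemma many_atoms (g : S -> C) (a : R) (W0 : set S) :
  (forall t, nowhere_dense (phi @^-1` [set t])) ->
  open W0 -> W0 !=set0 -> (forall s, W0 s -> a < rnorm (g (phi s) s)) ->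
  forall n, exists (l : seq S) (W : set S),
    [/\ uniq l, size l = n, open W, W !=set0 & W `<=` W0] /\
    forall s t, W s -> t \in l -> a < rnorm (g t s) /\ phi s <> t.
Proof.
move=> nd oW0 W00 ga; elim=> [|n [l [W [[ul sl oW [s Ws] WW0] Wl]]]].
  by exists [::], W0; split; [split | move=> s t _; rewrite in_nil].
pose W1 := W `&` [set x | a < rnorm (g (phi s) x)].
have oW1 : open W1 by apply: openI => //; exact: open_rnorm_gt.
have W1s : W1 s by split=> //; apply: ga; exact: WW0.
(* The nowhere dense fibre over [phi s] cannot contain [W1], so removing it leaves a nonempty open
   set. *)
have [x W1x phix] : exists2 x, W1 x & phi x <> phi s.
  apply: contrapT => /forall2NP nx.
  suff : interior (closure (phi @^-1` [set phi s])) s by rewrite nd.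
  rewrite /interior; apply: filterS (open_nbhs_nbhs (conj oW1 W1s)) => x W1x.
  by apply: subset_closure; have [//|/contrapT] := nx x.
exists (phi s :: l), (W1 `&` phi @^-1` (~` [set phi s])); split; first split.
- rewrite /= ul andbT; apply/negP => /(Wl _ _ Ws) [_]; exact.
- by rewrite /= sl.
- apply: openI => //; apply: open_comp; first by move=> y _; exact: cts_fun.
  apply: closed_openC.
  exact: accessible_closed_set1 (hausdorff_accessible hS) _.
- by exists x.
- by move=> y [[/WW0]].
move=> y t [[Wy gy] phiy]; rewrite in_cons => /orP[/eqP ->//|tl].
exact: Wl.
Qed.

Lemma small_atom (T : {linear C -> C}) (g : S -> C) (a : R) (W : set S) :
  continuous T -> (forall t, atom T t (g t)) ->
  (forall t, nowhere_dense (phi @^-1` [set t])) ->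
  0 < a -> open W -> W !=set0 -> exists2 s, W s & rnorm (g (phi s) s) <= a.
Proof.
move=> cT gT nd a0 oW W0; apply: contrapT => /forall2NP large.
(* As [n * a] exceeds [opnorm T], [n] atoms above [a] at one point are too many. *)
pose n := (Num.truncn (opnorm T / a)).+1.
have ga s : W s -> a < rnorm (g (phi s) s).
  by move=> Ws; rewrite ltNge; apply/negP; have [] := large s.
have [l [W' [[ul sl _ [s W's] _] W'l]]] := many_atoms nd oW W0 ga n.
have [||h [h1 _ [r hr nr]]] := atom_sum hS (a := a) (s := s) (V := setT) gT ul.
- by move=> t tl; have [] := W'l _ _ W's tl.
- by move=> t _; exact: filterT.
have : opnorm T < r.
  apply: lt_le_trans nr; rewrite sl -ltr_pdivrMr//.
  exact: truncnS_gt.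
rewrite ltNge => /negP; apply.
apply: le_trans (continuous_opnorm_ub cT h1).
apply: le_trans (supnorm_ub _ s).
by rewrite hr /rnorm normc_def/= expr0n addr0 sqrtr_sqr ler_norm.
Qed.

Lemma rnorm_wcomp (u : C) (f : C) : rnorm (wcomp u phi f) <= supnorm u * rnorm f.
Proof.
apply: supnorm_le => [|s]; first by rewrite mulr_ge0 ?supnorm_ge0 ?rnorm_ge0.
by rewrite wcompE rnormM ler_pM ?rnorm_ge0 ?supnorm_ub.
Qed.

Lemma wcomp_add_ub (u : C) (T : {linear C -> C}) : continuous T ->
  forall f, `|f| <= 1 -> rnorm ((wcomp u phi \+ T) f) <= supnorm u + opnorm T.
Proof.
move=> cT f f1; apply: le_trans (rnormD _ _) _.
apply: lerD; last exact: continuous_opnorm_ub.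
apply: le_trans (rnorm_wcomp u f) _; rewrite ler_piMr ?supnorm_ge0//.
by rewrite -lecR rnormE.
Qed.

(** Of the loss [5 * d], one [d] comes from the choice of [f] and [s], and [4 * d] from modifying
    [f] near [phi s]; [1 + d] bounds the norm of the modified function. *)
Lemma daugavet_approx (u : C) (T : {linear C -> C}) (g : S -> C) (d : R) :
  (forall s, rnorm (u s) = supnorm u) -> (exists s : S, True) ->
  continuous T -> (forall t, atom T t (g t)) ->
  (forall t, nowhere_dense (phi @^-1` [set t])) -> 0 < d ->
  supnorm u + opnorm T - 5 * d <= opnorm (wcomp u phi \+ T) * (1 + d).
Proof.
move=> uc [s0 _] cT gT nd d0.
have [|f f1 fT] := @opnorm_approx _ _ _ T (opnorm T - d).
  by rewrite ltrBlDr ltrDl.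
have [|_ [s1 _ <-] s1T] := sup_gt _ fT; first by exists (rnorm (T f s0)), s0.
have [|s sW gs] := small_atom cT gT nd d0 (open_rnorm_gt (T f) (opnorm T - d)).
  by exists s1.
rewrite /= in sW.
have fV : nbhs (phi s) [set x | rnorm (f x - f (phi s)) < d].
  have /cvgr_distC_lt /(_ d%:C) := @Cspace_continuous _ _ _ f (phi s).
  rewrite ltcR => /(_ d0); apply: filterS => x /=.
  by rewrite -rnormE ltcR.
have [p Vp pg] := gT (phi s) s _ _ fV d0.
have [p1 p0 p01] := Vp.
(* One [d] bounds the atom, the other the error of approximating it by [T p s]. *)
have Tp : rnorm (T p s) <= 2 * d.
  have := rnormD (T p s - g (phi s) s) (g (phi s) s); rewrite subrK; lra.
have [w w1 wu] := aligned (u s) (T f s).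
move/Cspace_norm_le1 in f1.
(* Since [p] is 1 at [phi s], [h] takes the aligned value [w] there. *)
pose h : C := f + (w - f (phi s)) *: p.
have h1 : rnorm h <= 1 + d.
  apply: supnorm_le => [|x]; first by lra.
  have /andP[px0 px1] := p01 x.
  (* A convex combination of [f x] and [w], plus an error of at most [d] because [p] vanishes where
     [f] is not [d]-close to [f (phi s)]. *)
  have -> : h x = f x * (1 - p x) + w * p x + (f x - f (phi s)) * p x :> R[i].
    by rewrite /h CaddE CscaleE; ring.
  rewrite -lecR rnormE rmorphD/= rmorph1.
  have pd : `|(f x - f (phi s)) * p x : R[i]| <= d%:C.
    rewrite normrM; have [Vx|nVx] := pselect (rnorm (f x - f (phi s)) < d).
      rewrite -[leRHS]mulr1 ler_pM//; last by rewrite ger0_norm.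
      by rewrite -[leLHS](rnormE (_ : R[i]^o)) lecR ltW.
    by rewrite (p0 x nVx) normr0 mulr0 lecR ltW.
  apply: le_trans (ler_normD _ _) _; apply: lerD => //.
  apply: le_trans (ler_normD _ _) _.
  rewrite !normrM (ger0_norm px0) (@ger0_norm _ (1 - p x)) ?subr_ge0//.
  rewrite -[leRHS](subrK (p x)); apply: lerD.
    rewrite ler_piMl ?subr_ge0//.
    by rewrite -[leLHS](rnormE (_ : R[i]^o)) (lecR _ 1).
  rewrite ler_piMl//.
  by rewrite -[leLHS](rnormE (_ : R[i]^o)) w1.
have -> : supnorm u + opnorm T - 5 * d = supnorm u + (opnorm T - d) - 4 * d by lra.
apply: (@le_trans _ _ (rnorm ((wcomp u phi \+ T) h))); last first.
  apply: le_trans (opnorm_bound (wcomp_add_ub u cT) h) _.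
  rewrite ler_wpM2l//.
  have N0 : `|0 : C| <= 1 by rewrite normr0.
  exact: le_trans (rnorm_ge0 _) (opnorm_ub (wcomp_add_ub u cT) N0).
apply: le_trans (supnorm_ub _ s).
(* By the choice of [w] the bracket has modulus [supnorm u + rnorm (T f s)]; the last term is a
   perturbation. *)
have -> : (wcomp u phi \+ T) h s =
    (u s * w + T f s) + (w - f (phi s)) * T p s :> R[i].
  rewrite /= CaddE wcompE /h linearD linearZ !CaddE !CscaleE p1; ring.
have hw : rnorm ((w - f (phi s)) * T p s : R[i]^o) <= 4 * d.
  have wf : rnorm (w - f (phi s) : R[i]^o) <= 2.
    apply: le_trans (rnormD _ _) _; rewrite rnormN w1.
    by have := f1 (phi s); lra.
  rewrite rnormM; apply: (@le_trans _ _ (2 * (2 * d))); last by lra.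
  by rewrite ler_pM ?rnorm_ge0.
have := rnormD ((u s * w + T f s : R[i]^o) + (w - f (phi s)) * T p s)
               (- ((w - f (phi s)) * T p s)).
by rewrite addrK rnormN wu uc; lra.
Qed.

End daugavet.

(** * Necessity: testing on rank-one operators *)

Section necessity.
Context {R : realType} {S : topologicalType} {cS : compact [set: S]}.
Hypothesis hS : hausdorff_space S.
Local Notation C := (Cspace R cS).
Variables (u : C) (phi : continuousType S S).
Hypothesis daugavet_rank1 : forall t (g : C),
  opnorm (wcomp u phi \+ rank1 t g) = supnorm u + opnorm (rank1 t g).

(** A bump at [t] is sent to [g]. *)
Lemma opnorm_rank1_ge t (g : C) : rnorm g <= opnorm (rank1 t g).
Proof.
have [p Vp] := bump_exists (cS := cS) (R := R) hS (filterT : nbhs t setT).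
have [p1 _ _] := Vp.
have pg : rank1 t g p = g by rewrite /rank1 p1 scale1r.
by rewrite -{1}pg (continuous_opnorm_ub (@rank1_continuous _ _ _ t g) (bump_ball Vp)).
Qed.

Lemma rnorm_bump t V (p : C) : bump t V p -> forall s, rnorm (p s) <= 1.
Proof. by move=> /bump_ball /Cspace_norm_le1. Qed.

Lemma daugavet_norm_const s : rnorm (u s) = supnorm u.
Proof.
apply/eqP; rewrite eq_le supnorm_ub/= leNgt; apply/negP => us.
(* With [m < supnorm u], the sum is at most [m + 1] where [p] may be nonzero and at most [supnorm u]
   elsewhere, but the equation demands at least [supnorm u + 1]. *)
pose m := (rnorm (u s) + supnorm u) / 2.
have sm : rnorm (u s) < m by rewrite /m; lra.
have mu : m < supnorm u by rewrite /m; lra.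
have sV : nbhs s [set x | rnorm (u x) < m].
  by apply: open_nbhs_nbhs; split=> //; exact: open_rnorm_lt.
have [p Vp] := bump_exists (cS := cS) (R := R) hS sV.
have [p1 p0 _] := Vp.
have N1 : 1 <= opnorm (rank1 s p).
  apply: le_trans (opnorm_rank1_ge s p).
  by apply: le_trans (supnorm_ub _ s); rewrite p1 rnorm1.
have : opnorm (wcomp u phi \+ rank1 s p) <= Num.max (m + 1) (supnorm u).
  apply: opnorm_le => f /Cspace_norm_le1 f1.
  apply: supnorm_le => [|x]; first by rewrite le_max supnorm_ge0 orbT.
  rewrite /= CaddE wcompE CscaleE le_max.
  have [Vx|nVx] := pselect (rnorm (u x) < m); last first.
    apply/orP; right; rewrite p0// mulr0 addr0 rnormM -[supnorm u]mulr1.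
    by rewrite ler_pM ?rnorm_ge0// supnorm_ub.
  apply/orP; left; apply: le_trans (rnormD _ _) _; rewrite !rnormM.
  apply: lerD.
    by rewrite -[m]mulr1 ler_pM ?rnorm_ge0// ltW.
  by rewrite mulr_ile1 ?rnorm_ge0// (rnorm_bump Vp).
rewrite daugavet_rank1 le_max => /orP[]; lra.
Qed.

Lemma daugavet_nowhere_dense : u != 0 ->
  forall t, nowhere_dense (phi @^-1` [set t]).
Proof.
move=> u0 t; rewrite /nowhere_dense -subset0 => s.
have /closure_id <- : closed (phi @^-1` [set t]).
  apply: (continuous_closedP phi).1; first exact: cts_fun.
  exact: accessible_closed_set1 (hausdorff_accessible hS) t.
move=> /(bump_exists hS (cS := cS) (R := R)) [p Vp]; have [p1 p0 p01] := Vp.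
(* The product of [u] and [p]; its norm reaches [supnorm u] at [s], where [p] is 1. *)
pose up : C := wcomp u idfun p.
have Nu : supnorm u <= opnorm (rank1 t (- up)).
  apply: le_trans (opnorm_rank1_ge t (- up)); rewrite rnormN.
  by apply: le_trans (supnorm_ub _ s); rewrite wcompE p1 mulr1 daugavet_norm_const.
have : opnorm (wcomp u phi \+ rank1 t (- up)) <= supnorm u.
  apply: opnorm_le => f /Cspace_norm_le1 f1.
  apply: supnorm_le => [|x]; first exact: supnorm_ge0.
  have -> : (wcomp u phi \+ rank1 t (- up)) f x =
      u x * (f (phi x) - f t * p x) :> R[i].
    rewrite -[LHS]/(u x * f (phi x) + f t * - (u x * p x) : R[i]); ring.
  rewrite rnormM daugavet_norm_const ler_piMr ?supnorm_ge0//.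
  (* Off the fibre [p] vanishes; on it the second factor is [f t * (1 - p x)], of modulus at most
     1. *)
  have [phix|nphix] := pselect (phi x = t); last first.
    by rewrite p0// mulr0 subr0.
  have /andP[px0 px1] := p01 x.
  rewrite phix (_ : _ - _ = f t * (1 - p x) :> R[i]); last by ring.
  rewrite rnormM mulr_ile1 ?rnorm_ge0//.
  by rewrite -lecR rnormE ger0_norm ?subr_ge0// gerBl.
(* The equation gives [2 * supnorm u <= supnorm u], against [u != 0]. *)
rewrite daugavet_rank1 => Nle.
have : supnorm u <= 0 by lra.
by rewrite leNgt -ltcR -Cspace_normE normr_gt0 u0.
Qed.

End necessity.

(** * The equivalence, with the limit in the approximate estimate *)

Theorem theorem2p1 (R : realType) (S : topologicalType)
    (cS : compact [set: S]) (hS : hausdorff_space S)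
    (niS : isolated [set: S] = set0)
    (u : Cspace R cS) (u_neq0 : u != 0) (phi : continuousType S S) :
  (forall T : {linear Cspace R cS -> Cspace R cS},
     continuous T -> weakly_compact T ->
     opnorm (wcomp u phi \+ T) = supnorm u + opnorm T)
  <->
  ((forall t : S, nowhere_dense (phi @^-1` [set t])) /\
   (exists c, forall s : S, `|u s| = c)).
Proof.
split=> [daugavet|[nd [c uc]] T cT wT].
  have D1 t g : opnorm (wcomp u phi \+ rank1 t g) = supnorm u + opnorm (rank1 t g).
    by apply: daugavet; [exact: rank1_continuous|exact: rank1_weakly_compact].
  split; first exact: daugavet_nowhere_dense.
  by exists (supnorm u)%:C => s; rewrite -(daugavet_norm_const hS D1 s) rnormE.
have [s0 us0] : exists s, u s != 0.
  apply: contrapT => /forallNP u0; case/eqP: u_neq0; apply: CspaceP => s.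
  by have /negP := u0 s; rewrite negbK => /eqP.
have ucst s : rnorm (u s) = supnorm u.
  apply/eqP; rewrite eq_le supnorm_ub/=.
  by apply: supnorm_le => [|x]; rewrite ?rnorm_ge0// rnorm_le !uc.
have /choice [g gT] t : exists g, atom T t g by exact: weakly_compact_atom.
apply/eqP; rewrite eq_le (opnorm_le (wcomp_add_ub phi u cT))/=.
set N := opnorm (wcomp u phi \+ T).
have N0 : 0 <= N.
  have z1 : `|0 : Cspace R cS| <= 1 by rewrite normr0.
  exact: le_trans (rnorm_ge0 _) (opnorm_ub (wcomp_add_ub phi u cT) z1).
apply/ler_addgt0Pr => e e0.
(* For [d = e / (5 + N)] the losses [5 * d] and [N * d] add up to [e]. *)
have d0 : 0 < e / (5 + N) by rewrite divr_gt0// ltr_wpDr.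
have := daugavet_approx hS ucst (ex_intro _ s0 I) cT gT nd d0.
rewrite -/N -lerBDr opprK => /le_trans; apply.
rewrite mulrDr mulr1 -addrA lerD2l -mulrDl addrC.
by rewrite mulrCA divff ?mulr1// gt_eqF// ltr_wpDr.
Qed.
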